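(* Let $H$ be an infinite-dimensional separable (real) Hilbert space, regarded as an element of $\mathrm{SB}$ by identifying it with an isometrically isomorphic closed linear subspace of $C(2^{\mathbb N})$, and let $(f_{t_n})_{n=0}^\infty$ be the Haar basis of $C(2^{\mathbb N})$. Then $$o\big(T_{NU}(H,(f_{t_n}))\big)=\omega+1 .$$
   Context: Spaces. $2^{\mathbb N}$ is the Cantor space of infinite binary sequences, and $C(2^{\mathbb N})$ is the Banach space of continuous real-valued functions on it with the supremum norm. Banach spaces are real. $\mathrm{SB}$ is the set of all closed linear subspaces of $C(2^{\mathbb N})$ (with the Effros Borel structure); every separable Banach space is isometrically isomorphic to an element of $\mathrm{SB}$. Fix Borel maps $d_n:\mathrm{SB}\to C(2^{\mathbb N})$, $n\in\mathbb N$, such that for every $X\in\mathrm{SB}$ the set $\{d_n(X): n\in\mathbb N\}$ is a dense subset of $X$. Haar basis. Let $\mathcal O\subseteq 2^{<\mathbb N}$ consist of the empty string together with all finite binary strings ending in $0$. Enumerate $\mathcal O$ as $t_0,t_1,t_2,\ldots$ by increasing length and, among strings of equal length, lexicographically (at the first index where they differ, the string with entry $0$ comes first); thus $t_0=\varnothing$, $t_1=(0)$, $t_2=(00)$, $t_3=(10)$, $t_4=(000)$, $t_5=(010)$, $t_6=(100)$, $t_7=(110)$, etc. Let $V_n=\{\alpha\in 2^{\mathbb N}: t_n \text{ is an initial segment of }\alpha\}$ and $f_{t_n}=\chi_{V_n}\in C(2^{\mathbb N})$. The sequence $(f_{t_n})_{n\ge 0}$ is a normalized monotone Schauder basis of $C(2^{\mathbb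 N})$, called the Haar basis. Equivalence. For $C\in[1,\infty)$, finite sequences $(x_n)_{n=0}^{m-1}$ in a Banach space $X$ and $(y_n)_{n=0}^{m-1}$ in a Banach space $Y$ are $C$-equivalent if for all real $a_0,\dots,a_{m-1}$, $$\tfrac1C\Big\|\sum_{n=0}^{m-1} a_nx_n\Big\|\le\Big\|\sum_{n=0}^{m-1} a_ny_n\Big\|\le C\Big\|\sum_{n=0}^{m-1} a_nx_n\Big\|.$$ Trees. A tree on a set $A$ is a set $T$ of finite sequences from $A$ closed under initial segments; it is well-founded if there is no infinite sequence in $A$ all of whose finite initial segments belong to $T$. Derivatives: $T^{(0)}=T$; $T^{(\xi+1)}=\{t\in T^{(\xi)}: \text{some } s\in T^{(\xi)} \text{ properly extends } t\}$; $T^{(\lambda)}=\bigcap_{\xi<\lambda}T^{(\xi)}$ for limit $\lambda$. For well-founded $T$, the order $o(T)$ is the least ordinal $\xi$ with $T^{(\xi)}=\varnothing$. Non-universal tree. For $X\in\mathrm{SB}$, $T_{NU}(X)=T_{NU}(X,(f_{t_n}))$ is the tree on $\mathbb N$ consisting of the empty sequence and all sequences $(k,\ell_0,\dots,\ell_{m-1})$ with $k\ge1$, $m\ge0$, such that $(d_{\ell_n}(X))_{n=0}^{m-1}$ is $k$-equivalent to $(f_{t_n})_{n=0}^{m-1}$ (for $m=0$ the condition is vacuous). It is well-founded whenever $X$ contains no isomorphic copy of $C(2^{\mathbb N})$ (known fact). *)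

(* Defs.v *)
From HB Require Import structures.
From mathcomp Require Import all_boot all_order all_algebra.
From mathcomp Require Import all_classical all_reals all_analysis.

Set Implicit Arguments.
Unset Strict Implicit.
Unset Printing Implicit Defensive.

Import Order.TTheory GRing.Theory Num.Theory.
Import numFieldNormedType.Exports.

Local Open Scope classical_set_scope.
Local Open Scope ring_scope.

Definition cantorC (R : realType) : Type := continuousType cantor_space R.

Section CantorC.
Variable R : realType.
Implicit Types (f g h : cantorC R) (a : R).

HB.instance Definition _ := Choice.on (cantorC R).

Lemma cantorC_cts f : continuous (f : cantor_space -> R).
Proof. by move=> x; exact: (@cts_fun _ _ f). Qed.

Lemma cantorCP f g : (forall x, f x = g x) -> f = g.
Proof. by move=> fg; apply/continuousEP. Qed.

Lemma cantorC0_cts : continuous (fun _ : cantor_space => 0 : R).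
Proof. by move=> x; exact: cvg_cst. Qed.

Lemma cantorCN_cts f : continuous (fun x : cantor_space => - f x).
Proof. by move=> x; apply: cvgN; exact: cantorC_cts. Qed.

Lemma cantorCD_cts f g : continuous (fun x : cantor_space => f x + g x).
Proof. by move=> x; apply: cvgD; exact: cantorC_cts. Qed.

Lemma cantorCZ_cts a f : continuous (fun x : cantor_space => a * f x).
Proof. by move=> x; apply: cvgM; [exact: cvg_cst|exact: cantorC_cts]. Qed.

Definition cantorC0 : cantorC R := mkcts cantorC0_cts.
Definition cantorCN f : cantorC R := mkcts (@cantorCN_cts f).
Definition cantorCD f g : cantorC R := mkcts (@cantorCD_cts f g).
Definition cantorCZ a f : cantorC R := mkcts (@cantorCZ_cts a f).

Lemma cantorC_addA : associative cantorCD.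
Proof. by move=> f g h; apply: cantorCP => x; exact: addrA. Qed.

Lemma cantorC_addC : commutative cantorCD.
Proof. by move=> f g; apply: cantorCP => x; exact: addrC. Qed.

Lemma cantorC_add0 : left_id cantorC0 cantorCD.
Proof. by move=> f; apply: cantorCP => x; exact: add0r. Qed.

Lemma cantorC_addN : left_inverse cantorC0 cantorCN cantorCD.
Proof. by move=> f; apply: cantorCP => x; exact: addNr. Qed.

HB.instance Definition _ := GRing.isZmodule.Build (cantorC R)
  cantorC_addA cantorC_addC cantorC_add0 cantorC_addN.

Lemma cantorC_scaleA a b f : cantorCZ a (cantorCZ b f) = cantorCZ (a * b) f.
Proof. by apply: cantorCP => x; exact: mulrA. Qed.

Lemma cantorC_scale1 : left_id 1 cantorCZ.
Proof. by move=> f; apply: cantorCP => x; exact: mul1r. Qed.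

Lemma cantorC_scaleDr : right_distributive cantorCZ +%R.
Proof. by move=> a f g; apply: cantorCP => x; exact: mulrDr. Qed.

Lemma cantorC_scaleDl f : {morph cantorCZ^~ f : a b / a + b}.
Proof. by move=> a b; apply: cantorCP => x; exact: mulrDl. Qed.

HB.instance Definition _ := GRing.Zmodule_isLmodule.Build R (cantorC R)
  cantorC_scaleA cantorC_scale1 cantorC_scaleDr cantorC_scaleDl.

Definition supnorm f : R := sup (range (fun x : cantor_space => `|f x|)).

Lemma supnorm_has_sup f : has_sup (range (fun x : cantor_space => `|f x|)).
Proof.
split; first by exists `|f point|, point.
have : compact (f @` [set: cantor_space]).
  apply: continuous_compact; last exact: cantor_space_compact.
  by apply: continuous_subspaceT; exact: cantorC_cts.
move=> /compact_bounded[M [_ fM]]; exists (M + 1) => _ [x _ <-].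
by apply: (fM (M + 1)); [rewrite ltrDl|exists x].
Qed.

Lemma supnorm_ge f x : `|f x| <= supnorm f.
Proof. by apply: sup_ubound; [case: (supnorm_has_sup f)|exists x]. Qed.

Lemma supnorm_le f (M : R) : (forall x, `|f x| <= M) -> supnorm f <= M.
Proof.
move=> fM; apply: ge_sup; first by case: (supnorm_has_sup f).
by move=> _ [x _ <-].
Qed.

Lemma ler_supnormD f g : supnorm (f + g) <= supnorm f + supnorm g.
Proof.
apply: supnorm_le => x; apply: le_trans (ler_normD _ _) _.
by apply: lerD; exact: supnorm_ge.
Qed.

Lemma supnormZ a f : supnorm (a *: f) = `|a| * supnorm f.
Proof.
have le b h : supnorm (b *: h) <= `|b| * supnorm h.
  apply: supnorm_le => x; rewrite [X in `|X|](_ : _ = b * h x)// normrM.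
  by rewrite ler_wpM2l// supnorm_ge.
apply/eqP; rewrite eq_le le /=; have [->|a0] := eqVneq a 0.
  by rewrite normr0 mul0r; apply: le_trans (supnorm_ge _ point).
have := le a^-1 (a *: f); rewrite scalerA mulVf// scale1r normfV.
by rewrite ler_pdivlMl// normr_gt0.
Qed.

Lemma supnorm0_eq0 f : supnorm f = 0 -> f = 0.
Proof.
move=> f0; apply: cantorCP => x; apply/eqP.
by rewrite -normr_le0 -f0 supnorm_ge.
Qed.

HB.instance Definition _ := Lmodule_isNormed.Build R (cantorC R)
  ler_supnormD supnormZ supnorm0_eq0.

End CantorC.

Record SB (R : realType) := MkSB {
  SBset :> set (cantorC R) ;
  SB_closed : closed SBset ;
  SB0 : SBset 0 ;
  SB_linear : forall (a : R) f g, SBset f -> SBset g -> SBset (a *: f + g) }.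

Definition effros (R : realType) : set_system (SB R) :=
  <<s [set [set X : SB R | X `&` U !=set0] | U in open] >>.

Definition borel (T : topologicalType) : set_system T := <<s @open T >>.

Definition effros_borel_fun (R : realType) (d : SB R -> cantorC R) : Prop :=
  forall B, borel B -> effros (d @^-1` B).

Definition dense_selection (R : realType) (d : nat -> SB R -> cantorC R) : Prop :=
  (forall n, effros_borel_fun (d n)) /\
  (forall X : SB R, range (d^~ X) `<=` X /\ X `<=` closure (range (d^~ X))).

Fixpoint words (n : nat) : seq (seq bool) :=
  if n is m.+1 then
    [seq false :: w | w <- words m] ++ [seq true :: w | w <- words m]
  else [:: [::]].

(* The strings of length n in the index set of the Haar basis (the empty string
   and the strings ending in 0, with false for 0), lexicographically. *)
Definition haar_level (n : nat) : seq (seq bool) :=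
  if n is m.+1 then [seq rcons w false | w <- words m] else [:: [::]].

(* No level is empty, so the first n.+1 levels contain at least n.+1 strings and
   the default value of nth is never used. *)
Definition haar_string (n : nat) : seq bool :=
  nth [::] (flatten [seq haar_level i | i <- iota 0 n.+1]) n.

Fact haar_string_first :
  [seq haar_string n | n <- iota 0 8] =
  [:: [::]; [:: false]; [:: false; false]; [:: true; false];
      [:: false; false; false]; [:: false; true; false];
      [:: true; false; false]; [:: true; true; false] ].
Proof. by []. Qed.

Definition cylinder (t : seq bool) : set cantor_space :=
  [set alpha | mkseq alpha (size t) = t].

Lemma cylinder_clopen t : clopen (cylinder t).
Proof.
have coord i b : clopen [set alpha : cantor_space | alpha i = b].
  apply: (@preimage_clopen _ _ (proj i : cantor_space -> bool) [set b]).
    by split; [exact: discrete_open|exact: discrete_closed].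
  exact: proj_continuous.
elim/last_ind: t => [|t b IH].
  by rewrite (_ : cylinder _ = setT); [exact: clopenT|by apply/seteqP; split].
rewrite (_ : cylinder _ = cylinder t `&` [set alpha | alpha (size t) = b]).
  exact: clopenI.
rewrite /cylinder; apply/seteqP; split=> alpha /=; rewrite size_rcons mkseqS.
  by move=> /rcons_inj[-> ->].
by move=> [-> ->].
Qed.

Lemma haar_cts (R : realType) n :
  continuous (\1_(cylinder (haar_string n)) : cantor_space -> R).
Proof.
set A := cylinder _; have [oA cA] : clopen A by exact: cylinder_clopen.
move=> x; have [Ax|nAx] := pselect (A x).
  apply: (@near_cst_continuous cantor_space R 1).
  apply: (filterS _ (open_nbhs_nbhs (conj oA Ax))).
  by move=> y Ay; rewrite indicE mem_set.
apply: (@near_cst_continuous cantor_space R 0).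
apply: (filterS _ (open_nbhs_nbhs (conj (closed_openC cA) nAx))).
by move=> y Ay; rewrite indicE memNset.
Qed.

Definition haar (R : realType) (n : nat) : cantorC R := mkcts (@haar_cts R n).

Definition equivalent_seqs (R : realType) (C : R) (V W : normedModType R)
    (m : nat) (x : 'I_m -> V) (y : 'I_m -> W) : Prop :=
  forall a : 'I_m -> R,
    C^-1 * `|\sum_(n < m) a n *: x n| <= `|\sum_(n < m) a n *: y n| /\
    `|\sum_(n < m) a n *: y n| <= C * `|\sum_(n < m) a n *: x n|.

Definition TNU (R : realType) (d : nat -> SB R -> cantorC R) (X : SB R) :
    set (seq nat) :=
  [set s | s = [::] \/
    exists (k : nat) (l : seq nat), [/\ s = k :: l, (1 <= k)%N &
      equivalent_seqs k%:R
        (fun n : 'I_(size l) => d (nth 0%N l n) X)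
        (fun n : 'I_(size l) => haar R n)]].

Definition infinite_dimensional (R : realType) (V : lmodType R) : Prop :=
  ~ exists (n : nat) (b : 'I_n -> V),
      forall x, exists a : 'I_n -> R, x = \sum_(i < n) a i *: b i.

Definition separable (T : topologicalType) : Prop :=
  exists2 D : set T, countable D & dense D.

(* Positive definiteness follows from the last clause. *)
Definition inner_product (R : realType) (V : normedModType R)
    (dot : V -> V -> R) : Prop :=
  [/\ forall x y, dot x y = dot y x,
      forall (a : R) x y z, dot (a *: x + y) z = a * dot x z + dot y z &
      forall x, dot x x = `|x| ^+ 2].

Definition identifies (R : realType) (V : normedModType R)
    (iota : {linear V -> cantorC R}) (X : SB R) : Prop :=
  (forall v, `|iota v| = `|v|) /\ range iota = X.

(* Notations for ordinals: osup f denotes the supremum of the ordinals f i, so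
   every ordinal is denoted by some term, but not by a unique one; two terms
   denote the same ordinal when each is ole the other. *)
Inductive ord : Type :=
  | ozero
  | osucc of ord
  | osup (J : Type) of (J -> ord).

Fixpoint ole (a b : ord) {struct a} : Prop :=
  match a with
  | ozero => True
  | osucc a' =>
      (fix lt_a' (b : ord) : Prop := (* a' < b *)
        match b with
        | ozero => False
        | osucc b' => ole a' b'
        | osup _ g => exists j, lt_a' (g j)
        end) b
  | osup _ f => forall i, ole (f i) b
  end.

Definition omega : ord := osup (fun n : nat => iter n osucc ozero).

Definition derivative (A : Type) (T : set (seq A)) : set (seq A) :=
  [set t | T t /\ exists u, u <> [::] /\ T (t ++ u)].

(* The derivatives decrease, so at a limit ordinal it is enough to intersect over
   a cofinal family, and intersecting over a family with a greatest element is
   harmless. The intersection with T matters only for the empty supremum 0. *)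
Fixpoint iter_derivative (A : Type) (T : set (seq A)) (a : ord) : set (seq A) :=
  match a with
  | ozero => T
  | osucc a' => derivative (iter_derivative T a')
  | osup J f => T `&` \bigcap_(j in [set: J]) iter_derivative T (f j)
  end.

(* o(T) = a; in particular T is then well-founded. *)
Definition tree_order_eq (A : Type) (T : set (seq A)) (a : ord) : Prop :=
  iter_derivative T a = set0 /\
  forall b, iter_derivative T b = set0 -> ole a b.

(* Main.v *)
Require Import Defs.
From HB Require Import structures.
From mathcomp Require Import all_boot all_order all_algebra.
From mathcomp Require Import all_classical all_reals all_analysis.
From mathcomp Require Import ring lra.
Import Order.TTheory GRing.Theory Num.Theory.
Import numFieldNormedType.Exports.
Local Open Scope classical_set_scope.
Local Open Scope ring_scope.

Set Implicit Arguments.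
Unset Strict Implicit.
Unset Printing Implicit Defensive.

(** The order is omega + 1 because, once the constant k at the root is fixed,
    the sequences through k have bounded length, whereas sequences of every
    length occur as k varies ([tree_order_eq_omega1]): each finite derivative
    still contains the empty sequence, and after omega steps nothing else is
    left.

    Bounded length for fixed k ([TNU_bounded]). The strings 1...10 with
    0, 1, 2, ... ones index Haar functions with pairwise disjoint supports, so
    every combination of N of them with coefficients of modulus 1 has norm at
    most 1. If x_0, ..., x_(N-1) in a Hilbert space are k-equivalent to these
    functions, each |x_i| is at least 1/k, and the signs can be chosen so that
    |sum_i eps_i x_i|^2 >= sum_i |x_i|^2 >= N / k^2. The left-hand side is at
    most k^2, hence N <= k^4 ([equivalent_seqs_disjoint_le]). A sequence through
    k can therefore not be so long that its positions include those of the first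
    k^4 + 1 of these functions.

    All lengths occur ([TNU_unbounded]). A finite sequence x is comparable to
    the unit vector basis of l^1 as soon as sum_i |a_i| <= K |sum_i a_i x_i| and
    |x_i| <= K, and two sequences that satisfy this are K^2-equivalent
    ([equivalent_seqs_l1]). The first n Haar functions satisfy it with K = 2^n
    ([l1_lower_haar]), n orthonormal vectors with K = n
    ([l1_lower_orthonormal]), and the estimate survives replacing the
    orthonormal vectors by close enough members of the dense sequence
    ([l1_lower_perturb]). *)

(** * Derivatives of trees *)

Lemma derivative_mono {A : Type} (S T : set (seq A)) :
  S `<=` T -> derivative S `<=` derivative T.
Proof. by move=> ST t [/ST Tt [u [u0 /ST Tu]]]; split=> //; exists u. Qed.

Lemma iter_derivative_sub {A : Type} (T : set (seq A)) (a : ord) :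
  iter_derivative T a `<=` T.
Proof. by elim: a => [|a IH|J f _] t //= [] // /IH. Qed.

(** Comparability of ordinal notations enters only through this dichotomy between
    a < b and the inclusion that b <= a would give. Running the induction on b
    outside and on a inside leaves two successors, where the derivative is
    monotone, or a supremum, where one term of the family decides. *)
Lemma lt_or_iter_derivative_sub {A : Type} (T : set (seq A)) (b a : ord) :
  ole (osucc a) b \/ iter_derivative T a `<=` iter_derivative T b.
Proof.
elim: b a => [|b IHb|J g IHg] a.
- by right; exact: iter_derivative_sub.
- elim: a => [|a _|I f IHf]; first by left.
  + by have [|sab] := IHb a; [left|right; exact: derivative_mono].
  + have [|nle] := pselect (ole (osup f) b); first by left.
    have [i nlei] : exists i, ~ ole (f i) b by apply/existsNP.
    by right=> t [_ /(_ i Logic.I)]; have [/nlei|] := IHf i; [|exact].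
- have [[j lt_j]|ge_j] := pselect (exists j, ole (osucc a) (g j)).
    by left; exists j.
  right=> t at_; split; first exact: iter_derivative_sub at_.
  move=> j _; have [lt_j|] := IHg j a; last exact.
  by case: ge_j; exists j.
Qed.

Lemma iter_derivative_nat_sub {A : Type} (T : set (seq A)) (n : nat) t :
  iter_derivative T (iter n osucc ozero) t ->
  exists2 u, (n <= size u)%N & T (t ++ u).
Proof.
elim: n t => [|n IH] t /=; first by move=> Tt; exists [::]; rewrite ?cats0.
move=> [_ [u [u0 /IH[v nv Tv]]]]; exists (u ++ v); last by rewrite catA.
by rewrite size_cat; case: u u0 Tv => // x u _ _;
  rewrite /= addSn ltnS (leq_trans nv)// leq_addl.
Qed.

(** Moving the first entry of u to the end of t gives a proper extension of t that
    still has n entries of u below it; this is where closure under prefixes is used, since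
    intermediate nodes must belong to T. *)
Lemma iter_derivative_nat_sup {A : Type} (T : set (seq A)) (n : nat) t u :
  (forall s v, T (s ++ v) -> T s) -> (n <= size u)%N -> T (t ++ u) ->
  iter_derivative T (iter n osucc ozero) t.
Proof.
move=> Tpre; elim: n t u => [|n IH] t u nu Ttu /=; first exact: Tpre Ttu.
split; first exact: (IH t u (ltnW nu)).
case: u nu Ttu => // x u nu Ttu; exists [:: x]; split=> //.
by apply: (IH _ u); rewrite // -catA.
Qed.

(** No nonempty node x :: s survives omega derivatives: that would need extensions
    of every finite length, all starting with x. The root survives because T has
    nodes of every length, and disappears at the next derivative. *)
Lemma tree_order_eq_omega1 {A : Type} (T : set (seq A)) :
  (forall s v, T (s ++ v) -> T s) ->
  (forall n, exists2 s, (n <= size s)%N & T s) ->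
  (forall x, exists N, forall s, T (x :: s) -> (size s <= N)%N) ->
  tree_order_eq T (osucc omega).
Proof.
move=> Tpre Tinf Tfin; split.
  have nonroot x s : ~ iter_derivative T omega (x :: s).
    move=> [_ Txs]; have [N TN] := Tfin x.
    have TN1 : iter_derivative T (iter N.+1 osucc ozero) (x :: s).
      exact: Txs N.+1 Logic.I.
    have [u Nu /TN] := iter_derivative_nat_sub TN1.
    by rewrite size_cat leqNgt (leq_trans Nu)// leq_addl.
  rewrite -subset0 => -[|x s] [Ts [u [u0 Tu]]]; last exact: nonroot Ts.
  by case: u u0 Tu => // x u _ /nonroot.
move=> b b0; have [//|] := lt_or_iter_derivative_sub T b omega.
move=> /(_ [::]); rewrite b0 => /(_ _)[].
split; first by have [s _ Ts] := Tinf 0%N; exact: (Tpre [::] s).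
move=> n _; have [s ns Ts] := Tinf n.
exact: (iter_derivative_nat_sup (t := [::]) Tpre ns Ts).
Qed.

(** * The enumeration of the Haar basis *)

(** The concatenation of the first N levels; [haar_string n] reads off its entry
    n for N = n.+1, and for every large enough N by [haar_string_nth]. *)
Definition haar_strings N := flatten [seq haar_level i | i <- iota 0 N].

Lemma haar_stringsS N : haar_strings N.+1 = haar_strings N ++ haar_level N.
Proof. by rewrite /haar_strings -addn1 iotaD map_cat flatten_cat /= cats0. Qed.

Lemma mem_words n w : (w \in words n) = (size w == n).
Proof.
elim: n w => [|n IH] [|b w] //=; rewrite ?mem_cat.
  by apply/negP=> /orP[] /mapP[].
rewrite eqSS -IH; apply/orP/idP => [[]/mapP[v vw [_ ->]]//|ww].
by case: b; [right|left]; apply/mapP; exists w.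
Qed.

Lemma words_uniq n : uniq (words n).
Proof.
elim: n => //= n IH; rewrite cat_uniq !map_inj_uniq ?IH//=; first last.
- by move=> ? ? [].
- by move=> ? ? [].
by rewrite andbT; apply/hasPn=> _ /mapP[v _ ->]; apply/mapP=> -[].
Qed.

Lemma size_haar_level n w : w \in haar_level n -> size w = n.
Proof.
case: n => [|n] /=; first by rewrite inE => /eqP->.
by move=> /mapP[v]; rewrite mem_words => /eqP vn ->; rewrite size_rcons vn.
Qed.

Lemma last_haar_level n w : w \in haar_level n -> last false w = false.
Proof.
case: n => [|n] /=; first by rewrite inE => /eqP->.
by move=> /mapP[v _ ->]; rewrite last_rcons.
Qed.

Lemma haar_level_uniq n : uniq (haar_level n).
Proof. by case: n => //= n; rewrite map_inj_uniq ?words_uniq//; exact: rcons_injl. Qed.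

Lemma haar_level_gt0 n : (0 < size (haar_level n))%N.
Proof.
case: n => //= n; rewrite size_map.
have : nseq n true \in words n by rewrite mem_words size_nseq.
by case: words.
Qed.

Lemma mem_haar_strings N w :
  w \in haar_strings N -> w \in haar_level (size w) /\ (size w < N)%N.
Proof.
move=> /flattenP[_ /mapP[i + ->] wi]; rewrite mem_iota => /andP[_ iN].
by rewrite (size_haar_level wi).
Qed.

Lemma leq_size_haar_strings N : (N <= size (haar_strings N))%N.
Proof.
elim: N => [//|N IH]; rewrite haar_stringsS size_cat -addn1.
by rewrite leq_add// haar_level_gt0.
Qed.

Lemma haar_strings_uniq N : uniq (haar_strings N).
Proof.
elim: N => // N IH; rewrite haar_stringsS cat_uniq IH haar_level_uniq andbT/=.
by apply/hasPn=> w /size_haar_level wN; apply/negP=> /mem_haar_strings[_];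
  rewrite wN ltnn.
Qed.

Lemma haar_strings_sorted N : sorted (relpre size leq) (haar_strings N).
Proof.
have tr : transitive (relpre (@size bool) leq) by move=> ? ? ?; exact: leq_trans.
rewrite sorted_pairwise//; elim: N => // N IH; rewrite haar_stringsS pairwise_cat IH/=.
apply/andP; split.
  apply/allrelP=> u v /mem_haar_strings[_ uN] /size_haar_level vN /=.
  by rewrite vN ltnW.
have : all (fun w => size w == N) (haar_level N).
  by apply/allP=> w /size_haar_level->.
elim: (haar_level N) => //= w s IHs /andP[/eqP wN sN]; rewrite IHs// andbT.
by apply: sub_all sN => v /eqP/= ->; rewrite wN.
Qed.

Lemma nth_haar_strings N N' n : (N <= N')%N -> (n < size (haar_strings N))%N ->
  nth [::] (haar_strings N') n = nth [::] (haar_strings N) n.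
Proof.
move=> NN' nN; rewrite -(subnKC NN'); elim: (N' - N)%N => [|k IH].
  by rewrite addn0.
rewrite addnS haar_stringsS nth_cat IH ifT//.
by apply: leq_trans nN _; elim: k {IH} => [|k IH];
  rewrite ?addn0// addnS haar_stringsS size_cat (leq_trans IH)// leq_addr.
Qed.

Lemma haar_string_nth N n : (n < size (haar_strings N))%N ->
  haar_string n = nth [::] (haar_strings N) n.
Proof.
move=> nN; have -> : haar_string n = nth [::] (haar_strings n.+1) n by [].
have [le|lt] := leqP N n.+1; first exact: nth_haar_strings le nN.
by rewrite (nth_haar_strings (ltnW lt))// leq_size_haar_strings.
Qed.

Lemma haar_string_level n : haar_string n \in haar_level (size (haar_string n)).
Proof.
have [] // := @mem_haar_strings n.+1 (haar_string n).
by apply: mem_nth; exact: leq_size_haar_strings.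
Qed.

Lemma haar_string_inj : injective haar_string.
Proof.
move=> i j; pose N := (maxn i j).+1.
have iN : (i < size (haar_strings N))%N.
  by apply: leq_trans (leq_size_haar_strings N); rewrite ltnS leq_maxl.
have jN : (j < size (haar_strings N))%N.
  by apply: leq_trans (leq_size_haar_strings N); rewrite ltnS leq_maxr.
rewrite (haar_string_nth iN) (haar_string_nth jN) => /eqP.
by rewrite nth_uniq ?haar_strings_uniq// => /eqP.
Qed.

Lemma leq_size_haar_string i j : (i <= j)%N ->
  (size (haar_string i) <= size (haar_string j))%N.
Proof.
move=> ij; have jN := leq_size_haar_strings j.+1.
have iN := leq_ltn_trans ij jN.
rewrite (haar_string_nth iN) (haar_string_nth jN).
have tr : transitive (relpre (@size bool) leq) by move=> ? ? ?; exact: leq_trans.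
by apply: (sorted_leq_nth tr _ [::] (haar_strings_sorted j.+1)) => // ?; exact: leqnn.
Qed.

Lemma haar_string_rcons w : exists n, haar_string n = rcons w false.
Proof.
have wN : rcons w false \in haar_strings (size w).+2.
  rewrite haar_stringsS mem_cat; apply/orP; right.
  by apply/mapP; exists w; rewrite // mem_words.
exists (index (rcons w false) (haar_strings (size w).+2)).
by rewrite (@haar_string_nth (size w).+2) ?index_mem ?nth_index.
Qed.

(** * Equivalence of finite sequences *)

(** Passing to subsequences: put on index j the sum of the coefficients of all i
    that are sent to j. *)
Lemma equivalent_seqs_reindex {R : realType} {V W : normedModType R} (C : R)
    {m m' : nat} (f : 'I_m -> 'I_m')
    (x : 'I_m -> V) (y : 'I_m -> W) (x' : 'I_m' -> V) (y' : 'I_m' -> W) :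
  (forall i, x i = x' (f i)) -> (forall i, y i = y' (f i)) ->
  equivalent_seqs C x' y' -> equivalent_seqs C x y.
Proof.
move=> xf yf xy' a; have := xy' (fun j => \sum_(i < m | f i == j) a i).
have pull (U : normedModType R) (z : 'I_m -> U) (z' : 'I_m' -> U) :
    (forall i, z i = z' (f i)) ->
    \sum_(j < m') (\sum_(i < m | f i == j) a i) *: z' j = \sum_(i < m) a i *: z i.
  move=> zf; rewrite [RHS](partition_big f xpredT)//=; apply: eq_bigr => j _.
  by rewrite scaler_suml; apply: eq_bigr => i /eqP <-; rewrite zf.
by rewrite (pull _ x)// (pull _ y).
Qed.

(** The lower half of a comparison with the unit vector basis of l^1; a bound on
    the norms of the vectors gives the upper half ([ler_norm_l1]). *)
Definition l1_lower {R : realType} {V : normedModType R} (K : R) {m : nat}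
    (x : 'I_m -> V) : Prop :=
  forall a : 'I_m -> R, \sum_(i < m) `|a i| <= K * `|\sum_(i < m) a i *: x i|.

Lemma ler_norm_l1 {R : realType} {V : normedModType R} (K : R) {m : nat}
    (x : 'I_m -> V) (a : 'I_m -> R) :
  (forall i, `|x i| <= K) ->
  `|\sum_(i < m) a i *: x i| <= K * \sum_(i < m) `|a i|.
Proof.
move=> xK; apply: le_trans (ler_norm_sum _ _ _) _; rewrite mulr_sumr.
by apply: ler_sum => i _; rewrite normrZ mulrC ler_wpM2r.
Qed.

Lemma equivalent_seqs_l1 {R : realType} {V W : normedModType R} (K : R)
    {m : nat} (x : 'I_m -> V) (y : 'I_m -> W) :
  0 < K -> l1_lower K x -> l1_lower K y ->
  (forall i, `|x i| <= K) -> (forall i, `|y i| <= K) ->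
  equivalent_seqs (K ^+ 2) x y.
Proof.
move=> K0 xl yl xK yK a; rewrite ler_pdivrMl ?exprn_gt0// expr2 -!mulrA; split.
  by apply: le_trans (ler_norm_l1 a xK) _; rewrite ler_pM2l.
by apply: le_trans (ler_norm_l1 a yK) _; rewrite ler_pM2l.
Qed.

(** The perturbation changes K |sum_i a_i e_i| by at most half of sum_i |a_i|,
    which is absorbed in the left-hand side. *)
Lemma l1_lower_perturb {R : realType} {V : normedModType R} (K : R) {m : nat}
    (e x : 'I_m -> V) :
  0 < K -> l1_lower K e -> (forall i, `|x i - e i| <= (2 * K)^-1) ->
  l1_lower (2 * K) x.
Proof.
move=> K0 el xe a; set S := \sum_(i < m) _.
have eS := el a; rewrite -/S in eS.
have d := ler_norm_l1 a xe; rewrite -/S in d.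
have -> : \sum_(i < m) a i *: x i =
    \sum_(i < m) a i *: e i + \sum_(i < m) a i *: (x i - e i).
  by rewrite -big_split; apply: eq_bigr => i _ /=; rewrite -scalerDr addrC subrK.
set u := \sum_(i < m) a i *: e i; set v := \sum_(i < m) _ *: _.
have : `|u| <= `|u + v| + `|v|.
  by rewrite -{1}[u](addrK v) ler_normB.
rewrite -/u in eS; rewrite -/v in d => uuv.
have Kv : K * `|v| <= S / 2.
  apply: le_trans (ler_wpM2l (ltW K0) d) _.
  by rewrite invfM mulrA mulrCA mulfV ?gt_eqF// mulr1 mulrC.
have Ku : K * `|u| <= K * `|u + v| + K * `|v| by rewrite -mulrDr ler_pM2l.
by rewrite -mulrA; lra.
Qed.

(** * Norm estimates for Haar functions *)

(** The string number n followed by ones. The strings of positive length that index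
    the basis end in 0, so those that are initial segments of this point are
    initial segments of [haar_string n]: evaluation of the basis at these points
    gives a triangular matrix with ones on the diagonal. *)
Definition haar_point (n : nat) : cantor_space := nth true (haar_string n).

Lemma haarE {R : realType} n x : haar R n x = \1_(cylinder (haar_string n)) x.
Proof. by []. Qed.

Lemma haar_point_diag {R : realType} n : haar R n (haar_point n) = 1.
Proof. by rewrite haarE indicE mem_set//; exact: mkseq_nth. Qed.

(** By the ordering the string number i is at least as long as the string
    number n. If it is longer, its last entry is 0 while the point has a 1 there. *)
Lemma haar_point_gt {R : realType} n i :
  (n < i)%N -> haar R i (haar_point n) = 0.
Proof.
move=> ni; rewrite haarE indicE memNset// /cylinder/=.
have := leq_size_haar_string (ltnW ni); rewrite leq_eqVlt => /orP[/eqP <-|].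
  by rewrite mkseq_nth => /haar_string_inj /eqP; rewrite ltn_eqF.
set s := haar_string n; set t := haar_string i => st ts.
have t0 : (0 < size t)%N by exact: leq_ltn_trans st.
have : nth false t (size t).-1 = false.
  by rewrite nth_last; apply: last_haar_level (haar_string_level i).
rewrite -{1}ts nth_mkseq ?prednK// /haar_point nth_default//.
by rewrite -ltnS prednK.
Qed.

Lemma norm_haar_le1 {R : realType} n x : `|haar R n x| <= 1.
Proof. by rewrite haarE indicE; case: (_ \in _); rewrite ?normr1 ?normr0. Qed.

Lemma cantorC_combE {R : realType} n (a : nat -> R) (f : nat -> cantorC R) x :
  (\sum_(i < n) a i *: f i) x = \sum_(i < n) a i * f i x.
Proof.
by elim: n => [|n IH]; rewrite ?big_ord0// !big_ord_recr/= -IH.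
Qed.

Lemma cantorC_norm_ge {R : realType} (f : cantorC R) x : `|f x| <= `|f|.
Proof. exact: supnorm_ge. Qed.

Lemma cantorC_norm_le {R : realType} (f : cantorC R) (M : R) :
  (forall x, `|f x| <= M) -> `|f| <= M.
Proof. exact: supnorm_le. Qed.

Lemma norm_haar {R : realType} n : `|haar R n| = 1.
Proof.
apply/eqP; rewrite eq_le cantorC_norm_le ?andTb; last exact: norm_haar_le1.
by have := cantorC_norm_ge (haar R n) (haar_point n); rewrite haar_point_diag normr1.
Qed.

(** Solving the triangular system given by the values at the points
    [haar_point j] bounds each coefficient by the norm plus the sum of the
    moduli of the previous coefficients, so that sum at most doubles, up to the
    norm, at each step. *)
Lemma l1_lower_haar {R : realType} m : l1_lower (2 ^+ m) (fun i : 'I_m => haar R i).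
Proof.
(* Coefficients extended by 0 to all natural numbers, so that initial sums and
   cross terms need no casts. *)
move=> a; pose b i := oapp a 0 (insub i).
have ba (i : 'I_m) : b i = a i by rewrite /b valK.
under eq_bigr do rewrite -ba; under [in leRHS]eq_bigr do rewrite -ba.
set f := \sum_(i < m) _ *: _.
(* The summand `|f| makes the recursion exactly doubling. *)
suff partial j : (j <= m)%N ->
    \sum_(i < j) `|b i| + `|f| <= 2 ^+ j * `|f|.
  by apply: le_trans (partial m (leqnn m)); rewrite lerDl.
elim: j => [|j IH] jm; first by rewrite big_ord0 expr0 mul1r add0r.
have fj : f (haar_point j) = \sum_(i < j) b i * haar R i (haar_point j) + b j.
  rewrite cantorC_combE -(big_mkord xpredT (fun i => b i * haar R i (haar_point j))).
  rewrite (big_cat_nat _ jm)//= [X in _ + X]big_nat [X in _ + X]big1.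
    by rewrite addr0 big_nat_recr//= big_mkord haar_point_diag mulr1.
  by move=> i /andP[ji _]; rewrite haar_point_gt ?mulr0.
have bj : `|b j| <= `|f| + \sum_(i < j) `|b i|.
  have -> : b j = f (haar_point j) - \sum_(i < j) b i * haar R i (haar_point j).
    by rewrite fj addrAC subrr add0r.
  apply: le_trans (ler_normB _ _) _; apply: lerD; first exact: cantorC_norm_ge.
  apply: le_trans (ler_norm_sum _ _ _) _; apply: ler_sum => i _.
  by rewrite normrM ler_piMr// norm_haar_le1.
have := IH (ltnW jm); rewrite big_ord_recr/= exprS; lra.
Qed.

(** The supports are the cylinders over 0, 10, 110, and so on: the number of
    leading ones of a point decides which of them, if any, contains it. *)
Lemma exists_disjoint_haar {R : realType} : exists ns : nat -> nat,
  forall n (eps : nat -> R), (forall i, `|eps i| = 1) ->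
    `|\sum_(i < n) eps i *: haar R (ns i)| <= 1.
Proof.
have [ns nsE] := choice (fun i => haar_string_rcons (nseq i true)).
exists ns => n eps eps1; apply: cantorC_norm_le => x.
have cyl i : cylinder (haar_string (ns i)) x ->
    x i = false /\ forall j, (j < i)%N -> x j = true.
  rewrite nsE /cylinder/= size_rcons size_nseq mkseqS => /rcons_inj[xi xlt].
  split=> // j ji.
  by have := nth_mkseq false x ji; rewrite xi nth_nseq ji => ->.
have disj i j : cylinder (haar_string (ns i)) x ->
    cylinder (haar_string (ns j)) x -> i = j.
  move=> /cyl[xi Ti] /cyl[xj Tj]; case: (ltngtP i j) => // [/Tj|/Ti].
    by rewrite xi.
  by rewrite xj.
rewrite (cantorC_combE _ _ (fun i => haar R (ns i))).
have [[i xi]|nx] := pselect (exists i : 'I_n, cylinder (haar_string (ns i)) x).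
  rewrite (bigD1 i)//= big1 ?addr0 => [|j ji].
    by rewrite normrM eps1 mul1r norm_haar_le1.
  rewrite haarE indicE memNset ?mulr0// => xj.
  by move: ji; rewrite -val_eqE/= (disj _ _ xj xi) eqxx.
rewrite big1 ?normr0// => j _; rewrite haarE indicE memNset ?mulr0// => xj.
by apply: nx; exists j.
Qed.

(** * Finite sequences in inner product spaces *)

Lemma dot_comb {R : realType} {H : normedModType R} {dot : H -> H -> R}
    (hdot : inner_product dot) (n : nat) (a : nat -> R) (e : nat -> H) z :
  dot (\sum_(i < n) a i *: e i) z = \sum_(i < n) a i * dot (e i) z.
Proof.
have [_ lin _] := hdot; elim: n => [|n IH].
  rewrite !big_ord0; have := lin 1 0 0 z.
  by rewrite scale1r addr0 mul1r => /eqP; rewrite -subr_eq subrr => /eqP.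
by rewrite !big_ord_recr/= addrC lin IH addrC.
Qed.

Lemma dot_sqr_normD {R : realType} {H : normedModType R} {dot : H -> H -> R}
    (hdot : inner_product dot) u (s : R) v :
  `|u + s *: v| ^+ 2 = `|u| ^+ 2 + 2 * s * dot u v + s ^+ 2 * `|v| ^+ 2.
Proof.
have [sym lin nrm] := hdot.
rewrite -!nrm addrC lin (sym v) (sym u) !lin (sym v u); ring.
Qed.

(** The new sign is chosen to make the cross term nonnegative. This replaces the
    average over all signs, which gives equality. *)
Lemma exists_signs {R : realType} {H : normedModType R} {dot : H -> H -> R}
    (hdot : inner_product dot) (n : nat) (h : nat -> H) :
  exists2 eps : nat -> R, (forall i, `|eps i| = 1) &
    \sum_(i < n) `|h i| ^+ 2 <= `|\sum_(i < n) eps i *: h i| ^+ 2.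
Proof.
elim: n => [|n [eps eps1 IH]].
  by exists (fun=> 1) => [i|]; rewrite ?normr1// !big_ord0 normr0 expr0n.
pose u := \sum_(i < n) eps i *: h i; pose s : R := if 0 <= dot u (h n) then 1 else -1.
exists (fun i => if (i < n)%N then eps i else s) => [i|].
  by case: ifP => // _; rewrite /s; case: ifP; rewrite ?normrN normr1.
rewrite !big_ord_recr/= ltnn.
under [in leRHS]eq_bigr do rewrite ltn_ord.
rewrite -/u (dot_sqr_normD hdot) -/u in IH *.
rewrite (_ : s ^+ 2 = 1); last by rewrite /s; case: ifP; rewrite ?sqrrN expr1n.
rewrite mul1r lerD2r -[leLHS]addr0 lerD//.
rewrite -mulrA pmulr_rge0// /s; case: ifP => [|/negbT]; first by rewrite mul1r.
by rewrite -ltNge => /ltW; rewrite mulN1r oppr_ge0.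
Qed.

(** Sequences like y span an isometric copy of l^infinity; the inequality is the
    cotype 2 estimate that bounds how close such a space can be to a Hilbert space. *)
Lemma equivalent_seqs_disjoint_le {R : realType} {H W : normedModType R}
    {dot : H -> H -> R} (hdot : inner_product dot) (C : R) (n : nat) (x : nat -> H) (y : nat -> W) :
  0 < C -> equivalent_seqs C (fun i : 'I_n => x i) (fun i : 'I_n => y i) ->
  (forall i, `|y i| = 1) ->
  (forall eps : nat -> R, (forall i, `|eps i| = 1) ->
     `|\sum_(i < n) eps i *: y i| <= 1) ->
  n%:R <= C ^+ 4.
Proof.
move=> C0 xy y1 ysum.
have [eps eps1 le_eps] := exists_signs hdot n x.
have x1 (i : 'I_n) : 1 <= C * `|x i|.
  have [_] := xy (fun j => (j == i)%:R).
  have pick (U : normedModType R) (z : nat -> U) :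
      \sum_(j < n) (j == i)%:R *: z j = z i.
    rewrite (bigD1 i)//= eqxx scale1r big1 ?addr0// => j /negbTE->.
    by rewrite scale0r.
  by rewrite !pick y1.
have [+ _] := xy (fun i => eps i).
rewrite ler_pdivrMl// => /le_trans/(_ (ler_wpM2l (ltW C0) (ysum _ eps1))).
rewrite mulr1 => xC.
have nC : n%:R <= C ^+ 2 * \sum_(i < n) `|x i| ^+ 2.
  have -> : n%:R = \sum_(i < n) (1 : R) by rewrite sumr_const card_ord.
  rewrite mulr_sumr; apply: ler_sum => i _.
  by rewrite -exprMn expr_ge1// mulr_ge0// ltW.
apply: le_trans nC _; rewrite (exprM C 2 2) [leRHS]expr2 ler_pM2l ?exprn_gt0//.
by apply: le_trans le_eps _; rewrite lerXn2r ?nnegrE// ltW.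
Qed.

(** Gram-Schmidt: infinite dimension provides a vector v outside the span of the
    vectors already found, and v minus its projection is normalized. *)
Lemma exists_orthonormal {R : realType} {H : normedModType R} {dot : H -> H -> R}
    (hdot : inner_product dot) (hinf : infinite_dimensional H) (n : nat) :
  exists e : nat -> H, forall i j, (i < n)%N -> (j < n)%N ->
    dot (e i) (e j) = (i == j)%:R.
Proof.
have [sym lin nrm] := hdot.
elim: n => [|n [e eo]]; first by exists (fun=> 0).
have [v vspan] : exists v, ~ exists a : 'I_n -> R, v = \sum_(i < n) a i *: e i.
  by apply/existsNP => spans; apply: hinf; exists n, (fun i => e i).
pose p := \sum_(i < n) dot v (e i) *: e i; pose w := v - p.
have w0 : w != 0.
  apply/eqP => /eqP; rewrite subr_eq0 => /eqP vp; apply: vspan.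
  by exists (fun i => dot v (e i)).
have we i : (i < n)%N -> dot w (e i) = 0.
  move=> ni; rewrite /w addrC -scaleN1r lin mulN1r.
  rewrite (dot_comb hdot _ (fun j => dot v (e j))).
  rewrite (bigD1 (Ordinal ni))//= eo// eqxx mulr1 big1 ?addr0 ?addNr// => j.
  by rewrite -val_eqE/= => /negbTE ji; rewrite eo// ji mulr0.
have dotZ (c : R) u z : dot (c *: u) z = c * dot u z.
  have := dot_comb hdot 1 (fun=> c) (fun=> u) z.
  by rewrite !big_ord_recl !big_ord0 !addr0.
exists (fun i => if (i < n)%N then e i else `|w|^-1 *: w) => i j.
rewrite !ltnS leq_eqVlt => /orP[/eqP->|ni]; rewrite leq_eqVlt => /orP[/eqP->|nj].
- rewrite ltnn eqxx dotZ sym dotZ nrm mulrA -expr2 -exprMn.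
  by rewrite mulVf ?normr_eq0// expr1n.
- by rewrite ltnn nj dotZ we// mulr0 gtn_eqF.
- by rewrite ltnn ni sym dotZ we// mulr0 ltn_eqF.
- by rewrite ni nj eo.
Qed.

(** By Parseval each coefficient is at most the norm of the combination. *)
Lemma l1_lower_orthonormal {R : realType} {H : normedModType R} {dot : H -> H -> R}
    (hdot : inner_product dot) (m : nat) (e : nat -> H) :
  (forall i j, (i < m)%N -> (j < m)%N -> dot (e i) (e j) = (i == j)%:R) ->
  l1_lower m%:R (fun i : 'I_m => e i).
Proof.
move=> eo a; pose b i := oapp a 0 (insub i).
have ba (i : 'I_m) : b i = a i by rewrite /b valK.
under eq_bigr do rewrite -ba; under [in leRHS]eq_bigr do rewrite -ba.
have [sym _ nrm] := hdot; set f := \sum_(i < m) _ *: _.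
have fe (j : 'I_m) : dot f (e j) = b j.
  rewrite (dot_comb hdot) (bigD1 j)//= eo// eqxx mulr1 big1 ?addr0// => i.
  by rewrite -val_eqE/= => /negbTE ij; rewrite eo// ij mulr0.
have f2 : `|f| ^+ 2 = \sum_(j < m) `|b j| ^+ 2.
  rewrite -nrm {1}/f (dot_comb hdot); apply: eq_bigr => j _.
  by rewrite sym fe real_normK ?num_real.
have -> : m%:R * `|f| = \sum_(j < m) `|f|.
  by rewrite sumr_const card_ord mulr_natl.
apply: ler_sum => j _.
rewrite -(ler_pXn2r (n := 2))// ?nnegrE// f2 (bigD1 j)//= lerDl.
by apply: sumr_ge0 => i _; exact: sqr_ge0.
Qed.

(** * The non-universal tree of a Hilbert space *)

Lemma TNU_prefix {R : realType} (d : nat -> SB R -> cantorC R) X s v :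
  TNU d X (s ++ v) -> TNU d X s.
Proof.
case: s => [|k l]; first by move=> _; left.
move=> [//|[_ [_ [[<- <-] k1 eq]]]]; right; exists k, l; split=> //.
have lv : (size l <= size (l ++ v))%N by rewrite size_cat leq_addr.
apply: (equivalent_seqs_reindex (f := widen_ord lv)) eq => i //=.
by rewrite nth_cat ltn_ord.
Qed.

Lemma TNU_bounded {R : realType} (d : nat -> SB R -> cantorC R)
    (hd : dense_selection d) (H : normedModType R) (dot : H -> H -> R)
    (hdot : inner_product dot) (iota : {linear H -> cantorC R}) (X : SB R)
    (hX : identifies iota X) (k : nat) :
  exists N, forall l, TNU d X (k :: l) -> (size l <= N)%N.
Proof.
have [iso rng] := hX; have [ns disj] := @exists_disjoint_haar R.
(* One more function than a Hilbert space allows for the constant k. *)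
pose n := (k ^ 4).+1.
exists (\max_(i < n) ns i) => l [//|[_ [_ [[<- <-] k1 eq]]]].
rewrite leqNgt; apply/negP => lt_l.
have nsl (i : 'I_n) : (ns i < size l)%N.
  by apply: leq_ltn_trans lt_l; exact: (leq_bigmax i).
have /choice[h hE] i : exists v, iota v = d (nth 0%N l (ns i)) X.
  have : SBset X (d (nth 0%N l (ns i)) X).
    by have [_ /(_ X)[sub _]] := hd; apply: sub; exists (nth 0%N l (ns i)).
  by rewrite -rng => -[v _ vE]; exists v.
have k0 : 0 < k%:R :> R by rewrite ltr0n.
have heq : equivalent_seqs k%:R (fun i : 'I_n => h i) (fun i : 'I_n => haar R (ns i)).
  have := equivalent_seqs_reindex (f := fun i => Ordinal (nsl i))
    (x := fun i : 'I_n => iota (h i)) (fun i => hE i) (fun=> erefl) eq.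
  move=> eqi a; have := eqi a.
  have -> : \sum_(i < n) a i *: iota (h i) = iota (\sum_(i < n) a i *: h i).
    by rewrite linear_sum; apply: eq_bigr => i _; rewrite linearZ.
  by rewrite iso.
have := equivalent_seqs_disjoint_le (y := fun i => haar R (ns i)) hdot k0 heq.
move=> /(_ (fun i => norm_haar _) (disj n)).
by rewrite -natrX ler_nat ltnn.
Qed.

Lemma TNU_unbounded {R : realType} (d : nat -> SB R -> cantorC R)
    (hd : dense_selection d) (H : normedModType R) (dot : H -> H -> R)
    (hdot : inner_product dot) (hinf : infinite_dimensional H)
    (iota : {linear H -> cantorC R}) (X : SB R) (hX : identifies iota X) (n : nat) :
  exists2 s, (n <= size s)%N & TNU d X s.
Proof.
have [iso rng] := hX; have [e eo] := exists_orthonormal hdot hinf n.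
pose K : R := 2 ^+ n; have K1 : 1 <= K by rewrite exprn_ege1// ler1n.
have K0 : 0 < K by exact: lt_le_trans K1.
have /choice[L LE] i : exists l, `|d l X - iota (e i)| < (2 * K)^-1.
  have : closure (range (d^~ X)) (iota (e i)).
    by have [_ /(_ X)[_ cl]] := hd; apply: cl; rewrite -rng; exists (e i).
  move=> /(_ (ball (iota (e i)) (2 * K)^-1)) [|_ [[l _ <-]]].
    by apply: nbhsx_ballx; rewrite invr_gt0 mulr_gt0.
  by rewrite -ball_normE /ball_/= distrC; exists l.
pose l := mkseq L n; have ln : size l = n by rewrite size_mkseq.
(* 2 K = 2 ^ n.+1 is the l^1 constant after perturbation; it also serves for
   the Haar functions and bounds all norms involved. *)
exists ((2 ^ n.+1) ^ 2 :: l)%N; first by rewrite /= ln.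
right; exists ((2 ^ n.+1) ^ 2)%N, l; split; rewrite ?expn_gt0//.
have -> : ((2 ^ n.+1) ^ 2)%N%:R = (2 * K) ^+ 2 by rewrite !natrX [_ ^+ n.+1]exprS.
have lL (i : 'I_(size l)) : nth 0%N l i = L i by rewrite nth_mkseq// -ln.
have in_ (i : 'I_(size l)) : (i < n)%N by rewrite -ln.
have dK (i : 'I_(size l)) : `|d (nth 0%N l i) X - iota (e i)| <= (2 * K)^-1.
  by rewrite lL ltW.
have el : l1_lower K (fun i : 'I_(size l) => iota (e i)).
  move=> a.
  have -> : \sum_(i < size l) a i *: iota (e i) = iota (\sum_(i < size l) a i *: e i).
    by rewrite linear_sum; apply: eq_bigr => i _; rewrite linearZ.
  have eol i j : (i < size l)%N -> (j < size l)%N -> dot (e i) (e j) = (i == j)%:R.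
    by rewrite ln; exact: eo.
  rewrite iso; apply: le_trans (l1_lower_orthonormal hdot eol a) _.
  by rewrite ler_wpM2r// ln /K -natrX ler_nat ltnW// ltn_expl.
have K2 : 0 < 2 * K by rewrite mulr_gt0.
apply: equivalent_seqs_l1 => //.
- exact: l1_lower_perturb dK.
- move=> a; apply: le_trans (l1_lower_haar a) _; rewrite ler_wpM2r// ln -/K; lra.
- move=> i; rewrite -[d _ _](subrK (iota (e i))).
  apply: le_trans (ler_normD _ _) _; rewrite iso.
  have -> : `|e i| = 1.
    have [_ _ nrm] := hdot; apply/eqP; rewrite -sqrp_eq1// -nrm eo//.
    by rewrite eqxx.
  have /le_trans -> := lerD (dK i) (lexx 1) => //.
  have : (2 * K)^-1 <= 1 by rewrite invf_le1//; lra.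
  lra.
- by move=> i; rewrite norm_haar; lra.
Qed.

Theorem theorem1 (R : realType)
    (d : nat -> SB R -> cantorC R) (hd : dense_selection d)
    (H : completeNormedModType R)
    (dot : H -> H -> R) (hdot : inner_product dot)
    (hsep : separable H) (hinf : infinite_dimensional H)
    (iota : {linear H -> cantorC R}) (X : SB R) (hX : identifies iota X) :
  tree_order_eq (TNU d X) (osucc omega).
Proof.
apply: tree_order_eq_omega1.
- exact: TNU_prefix.
- by move=> n; exact: (TNU_unbounded hd hdot hinf hX n).
- by move=> k; exact: (TNU_bounded hd hdot hX k).
Qed.
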